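(* For every integer $m\ge 1$, the following identities of symmetric polynomials in $\mathbf x=(x_1,\dots,x_m)$ hold. (A) $\displaystyle\prod_{i=1}^m(1+x_i^2)=\sum_{b=0}^m\sum_{j=0}^{\lfloor (m-b)/2\rfloor}(-1)^j\,S^{\mathrm{U}(m)}_{(2^b,1^{2j})}(\mathbf x).$ (B) $\displaystyle\frac12\left(\prod_{i=1}^m(1+x_i^2)+\prod_{i=1}^m(1-x_i^2)\right)=\sum_{\substack{(b+2j,b)\trianglelefteq(m^2)\\ b+j\equiv_2 0}}(-1)^j\,S^{\mathrm{U}(m)}_{(2^b,1^{2j})}(\mathbf x),$ where the sum is over integers $b,j\ge 0$. (C) $\displaystyle\prod_{i=1}^m(1+x_i)(1+x_i^2)=\sum_{\substack{\lambda\trianglelefteq(3^m)\\ \lambda=(3^k,2^b,1^z)}}\tau(z,b)\,S^{\mathrm{U}(m)}_\lambda(\mathbf x).$ (D) $\displaystyle\frac12\left(\prod_{i=1}^m(1+x_i)(1+x_i^2)+\prod_{i=1}^m(1+x_i)(1-x_i^2)\right)=\sum_{\lambda\trianglelefteq(3^m)}\omega_\epsilon(z,b')\,S^{\mathrm{U}(m)}_\lambda(\mathbf x),$ where, for each $\lambda\trianglelefteq(3^m)$, the transpose of $\lambda$ is written as $\lambda'=(a+2k,b+2k,\epsilon+2k)$ with $k\ge 0$, $\epsilon\in\{0,1\}$, $a\ge b\ge\epsilon$, and $z:=a-b$, $b':=b-\epsilon$. The functions $\tau$ and $\omega_\epsilon$ are given in the context.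
   Context: $m\equiv_k m'$ means $k\mid m-m'$. A partition is a non-increasing finite sequence of non-negative integers (trailing zeros allowed); $\lambda\trianglelefteq\mu$ means containment of Young diagrams; $\lambda'$ is the transpose of $\lambda$; $(m_1^{k_1},m_2^{k_2},\dots)$ denotes the partition with $k_i$ parts equal to $m_i$ (here $k_i\ge0$ is allowed). $S^{\mathrm{U}(m)}_\lambda$ is the Schur polynomial in $m$ variables attached to $\lambda$ (the irreducible character of $\mathrm{U}(m)$ with highest weight $\lambda$). Tables. Functions below depend on residues of their two arguments; the matrix entry in row $r$, column $s$ (numbered from $0$) is the value when the first argument is $\equiv r$ and the second is $\equiv s$, modulo $4$ for $4\times4$ matrices and modulo $2$ for $2\times 2$ matrices. $$\tau=\begin{pmatrix}1&1&0&0\\1&0&-1&0\\0&-1&-1&0\\0&0&0&0\end{pmatrix}.$$ $$\omega_\epsilon(z,b')=\frac{\alpha_\epsilon(z,b')\cdot(b',z)+\beta_\epsilon(z,b')}{4},\qquad (x,y)\cdot(b',z)=xb'+yz,$$ $$\alpha_0=\begin{pmatrix}(1,1)&(-1,0)\\(0,1)&(0,0)\end{pmatrix},\quad \alpha_1=\begin{pmatrix}(-1,-1)&(1,0)\\(0,-1)&(0,0)\end{pmatrix},$$ $$\beta_0=\begin{pmatrix}4&1&2&-1\\3&0&-1&0\\2&-3&0&-1\\1&0&1&0\end{pmatrix},\quad \beta_1=\begin{pmatrix}0&3&-2&1\\1&0&-3&0\\-2&-1&-4&1\\-1&0&-1&0\end{pmatrix}.$$ *)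

(* Defs.v *)
(* Mathematical Components; multivariate polynomials from multinomials. *)
From HB Require Import structures.
From mathcomp Require Import all_boot all_order all_algebra.
From mathcomp Require Import mpoly.

Set Implicit Arguments.
Unset Strict Implicit.
Unset Printing Implicit Defensive.

Import GRing.Theory.

Definition is_part (l : seq nat) : bool := sorted geq l.

(* Beyond its last part a partition has parts 0, which is the default of [nth];
   past the index [size l] there is nothing to compare. *)
Definition dgle (l mu : seq nat) : bool :=
  all (fun i => nth 0 l i <= nth 0 mu i) (iota 0 (size l)).

Definition conj_part (l : seq nat) : seq nat :=
  [seq count (fun p => j < p) l | j <- iota 0 (head 0 l)].

(* The boxes of the Young diagram of [l]: pairs of a row i < size l and a
   column j < l_i, both numbered from 0. *)
Definition cell (l : seq nat) : finType :=
  {i : 'I_(size l) & 'I_(nth 0 l i)}.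

Definition cell_row (l : seq nat) (c : cell l) : nat := tag c.
Definition cell_col (l : seq nat) (c : cell l) : nat := tagged c.

Definition is_ssyt (m : nat) (l : seq nat) (T : {ffun cell l -> 'I_m}) : bool :=
  [forall c : cell l, forall d : cell l,
     ((cell_row c == cell_row d) && (cell_col c < cell_col d) ==> (T c <= T d))
  && ((cell_col c == cell_col d) && (cell_row c < cell_row d) ==> (T c < T d))].

Local Open Scope ring_scope.

(* The Schur polynomial in m variables, as the weight generating function of the
   semistandard tableaux of shape [l] with entries in {0, ..., m - 1}. It is 0
   when [l] has more than m nonzero parts. Rational coefficients are needed for
   the factors 1/2 and 1/4. *)
Definition schur (m : nat) (l : seq nat) : {mpoly rat[m]} :=
  \sum_(T : {ffun cell l -> 'I_m} | is_ssyt T) \prod_(c : cell l) 'X_(T c).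

(* [table n d M r s]: the entry of the n x n matrix M at the residues of r and s
   modulo n. *)
Definition table (T : Type) (n : nat) (d : T) (M : seq (seq T)) (r s : nat) : T :=
  nth d (nth [::] M (r %% n)%N) (s %% n)%N.

Definition tau (z b : nat) : int :=
  table 4 0 [:: [:: 1;  1;  0; 0];
                [:: 1;  0; -1; 0];
                [:: 0; -1; -1; 0];
                [:: 0;  0;  0; 0]] z b.

Definition alpha (eps z b' : nat) : int * int :=
  table 2 (0, 0)
    (if eps == 0%N
     then [:: [:: (1, 1); (-1, 0)];
              [:: (0, 1); (0, 0)]]
     else [:: [:: (-1, -1); (1, 0)];
              [:: (0, -1); (0, 0)]]) z b'.

Definition beta (eps z b' : nat) : int :=
  table 4 0
    (if eps == 0%N
     then [:: [:: 4;  1;  2; -1];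
              [:: 3;  0; -1;  0];
              [:: 2; -3;  0; -1];
              [:: 1;  0;  1;  0]]
     else [:: [::  0;  3; -2; 1];
              [::  1;  0; -3; 0];
              [:: -2; -1; -4; 1];
              [:: -1;  0; -1; 0]]) z b'.

Definition omega (eps z b' : nat) : rat :=
  ((alpha eps z b').1 * b'%:Z + (alpha eps z b').2 * z%:Z + beta eps z b')%:~R
    / 4%:R.

(* The coefficient of the Schur polynomial of [l] (with parts at most 3) when
   l' = (a + 2k, b + 2k, eps + 2k), eps in {0, 1}: then k and eps are the
   quotient and remainder of l'_3 by 2. *)
Definition omega_part (l : seq nat) : rat :=
  let l' := conj_part l in
  let k := (nth 0 l' 2)./2 in
  let eps := odd (nth 0 l' 2) : nat in
  let a := (nth 0 l' 0 - k.*2)%N in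
  let b := (nth 0 l' 1 - k.*2)%N in
  let z := (a - b)%N in
  let b' := (b - eps)%N in
  omega eps z b'.

(* The multiplicities of 1 and 2 in l = (3^k, 2^b, 1^z) are z and b. *)
Definition tau_part (l : seq nat) : rat :=
  (tau (count_mem 1%N l) (count_mem 2%N l))%:~R.

(* Every partition contained in (3^m), padded with zeros to m parts, is
   [tpart t] for exactly one m-tuple t over {0, 1, 2, 3}; sums over such
   partitions are taken over these tuples. *)
Definition tpart (m : nat) (t : m.-tuple 'I_4) : seq nat :=
  [seq nat_of_ord i | i <- t].

(* Main.v *)
Require Import Defs.
From mathcomp Require Import all_boot all_order all_algebra.
From mathcomp Require Import mpoly.
From mathcomp Require Import ring zify.
Import GRing.Theory.
Set Implicit Arguments.
Unset Strict Implicit.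
Unset Printing Implicit Defensive.
Local Open Scope ring_scope.

(** Let c assign a coefficient to every shape h with at most three columns.
    The sum of c(h) s_h(x_1, ..., x_n) is the generating function of all
    tableaux with entries below n, each weighted by the coefficient of its
    shape.  Removing from a tableau the cells that contain the largest entry
    leaves a tableau T in the remaining entries; conversely that entry can be
    added back at the foot of any set e of columns of T, provided that the new
    column heights h + e are still non-increasing.  Hence, if for every shape h
    the polynomial in y given by the sum over such e of c(h + e) y^|e| equals
    c(h) f(y), the last variable contributes the factor f(x_n), and by
    induction the whole sum is c(empty) f(x_1) ... f(x_n).  This is [sum_tab];
    for a cubic f with constant term 1, the condition on c is the set of three
    linear recurrences [pieri3].

    The left-hand sides of the theorem are such products, or half the sum of
    two of them, for f equal to 1 + y^2, 1 - y^2, (1 + y)(1 + y^2) and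
    (1 + y)(1 - y^2).  The corresponding coefficients depend on the
    multiplicities z, b, k of the parts 1, 2, 3:
    - (-1)^(z/2) for z even and k = 0, and 0 otherwise;
    - (-1)^b for z even and k = 0, and 0 otherwise;
    - tau(z, b);
    - (-1)^k (2 omega_0(z, b) - tau(z, b)).
    The recurrences depend on z and b through their residues modulo 2 or 4, up
    to terms linear in z and b, and are checked class by class
    ([pieri_coef2_plus], [pieri_coef2_minus], [pieri_coef3_plus],
    [pieri_coef3_minus]).  For the last two functions, the missing terms of the
    recurrences at the walls z = 0 and b = 0 do no harm because tau and omega_0
    vanish when z or b is taken to be -1.  Finally the mean of the last two
    coefficients is omega_eps, eps being the parity of k, since
    omega_0 + omega_1 = tau.

    To avoid tableaux whose type depends on the shape, all tableaux are
    encoded as fillings of one rectangle, blank outside of the diagram;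
    [schur_filling] recovers the Schur polynomial from those of a given
    shape. *)

(** * Fillings of a rectangle as tableaux *)

Lemma card_ord_lt (n m : nat) : (m <= n)%N -> #|[pred j : 'I_n | (j < m)%N]| = m.
Proof. by move=> mn; rewrite -sum1_card (big_ord_narrow mn) sum1_card card_ord. Qed.

Lemma down_closed_card (n : nat) (P : pred 'I_n) (i : 'I_n) :
  (forall a b : 'I_n, (a <= b)%N -> P b -> P a) -> P i = (i < #|P|)%N.
Proof.
move=> dP; case Pi: (P i); apply/esym.
  rewrite -[X in (X <= _)%N](card_ord_lt (ltn_ord i)).
  by apply: subset_leq_card; apply/subsetP => j; rewrite !inE ltnS => /dP; apply.
apply: negbTE; rewrite -leqNgt -[X in (_ <= X)%N](card_ord_lt (ltnW (ltn_ord i))).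
apply: subset_leq_card; apply/subsetP => j; rewrite !inE => Pj.
by rewrite ltnNge; apply/negP => /dP /(_ Pj); rewrite Pi.
Qed.

(** The value [ord_max] marks a blank cell. *)
Definition filling (n s : nat) := {ffun 'I_n * 'I_s -> 'I_n.+1}.

(** Semistandard tableaux with entries below [k], the shape being implicit.
    Since the blank is the largest value, weak increase along rows also says
    that the blanks of a row are on the right; the columns increase strictly
    until they become blank. *)
Definition tab (n s k : nat) (G : filling n s) : bool :=
  [&& [forall p, (G p < k)%N || (G p == ord_max)],
      [forall i, forall j : 'I_s, forall j' : 'I_s,
        (j <= j')%N ==> (G (i, j) <= G (i, j'))%N]
    & [forall j, forall i : 'I_n, forall i' : 'I_n, (i < i')%N ==>
        ((G (i, j) < G (i', j))%N || (G (i', j) == ord_max))]].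

Lemma tabP (n s k : nat) (G : filling n s) :
  reflect [/\ forall p, (G p < k)%N || (G p == ord_max),
     forall i (j j' : 'I_s), (j <= j')%N -> (G (i, j) <= G (i, j'))%N
   & forall j (i i' : 'I_n), (i < i')%N ->
        (G (i, j) < G (i', j))%N || (G (i', j) == ord_max)] (tab k G).
Proof.
apply: (iffP and3P) => -[H1 H2 H3]; split.
- exact/forallP.
- by move=> i j j'; apply/implyP; move/forallP: H2 => /(_ i)/forallP/(_ j)/forallP.
- by move=> j i i'; apply/implyP; move/forallP: H3 => /(_ j)/forallP/(_ i)/forallP.
- exact/forallP.
- by do 3 apply/forallP => ?; apply/implyP/H2.
- by do 3 apply/forallP => ?; apply/implyP/H3.
Qed.

Definition ht (n s : nat) (G : filling n s) : {ffun 'I_s -> nat} :=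
  [ffun j => #|[pred i | G (i, j) != ord_max]|].

Definition nonincr (s : nat) (h : {ffun 'I_s -> nat}) : bool :=
  [forall j : 'I_s, forall j' : 'I_s, (j <= j')%N ==> (h j' <= h j)%N].

Lemma nonincrP (s : nat) (h : {ffun 'I_s -> nat}) :
  reflect (forall j j' : 'I_s, (j <= j')%N -> (h j' <= h j)%N) (nonincr h).
Proof.
apply: (iffP forallP) => H j; first by move=> j'; apply/implyP; move/forallP: (H j).
by apply/forallP => j'; apply/implyP/H.
Qed.

Lemma ord_neq_max (n : nat) (v : 'I_n.+1) : (v != ord_max) = (v < n)%N.
Proof. by rewrite -val_eqE /= ltn_neqAle -ltnS ltn_ord andbT. Qed.

(** The cells in use of a column are its topmost ones, so the heights
    determine the diagram. *)
Lemma htE (n s k : nat) (G : filling n s) (i : 'I_n) (j : 'I_s) :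
  tab k G -> (G (i, j) != ord_max) = (i < ht G j)%N.
Proof.
move=> /tabP [_ _ H3]; rewrite ffunE.
apply: (down_closed_card (P := fun i => G (i, j) != ord_max)) => a b.
rewrite leq_eqVlt => /predU1P [/val_inj -> //|/(H3 j)] /=.
rewrite !ord_neq_max -val_eqE /=; lia.
Qed.

Lemma ht_nonincr (n s k : nat) (G : filling n s) : tab k G -> nonincr (ht G).
Proof.
move=> /tabP [_ H2 _]; apply/nonincrP => j j' jj'; rewrite !ffunE.
apply: subset_leq_card; apply/subsetP => i; rewrite !inE !ord_neq_max.
exact/leq_ltn_trans/H2.
Qed.

(** A strictly increasing column of entries below [k] has at most [k] cells;
    hence a further row fits into the rectangle when [k < n]. *)
Lemma ht_le (n s k : nat) (G : filling n s) (j : 'I_s) :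
  tab k G -> (k <= n)%N -> (ht G j <= k)%N.
Proof.
move=> tG kn; have [H1 _ H3] := tabP _ _ tG.
have lb (i : nat) (lt_in : (i < n)%N) : (i <= G (Ordinal lt_in, j))%N.
  elim: i lt_in => [//|i IH] lt_in.
  have := H3 j (Ordinal (ltnW lt_in)) (Ordinal lt_in) (leqnn _).
  have := IH (ltnW lt_in); rewrite -val_eqE /=; lia.
rewrite leqNgt; apply/negP => lt_k.
have lt_kn : (k < n)%N.
  apply: leq_trans lt_k _; rewrite ffunE.
  by apply: leq_trans (max_card _) _; rewrite card_ord.
have := htE (Ordinal lt_kn) j tG; rewrite /= lt_k.
by have /orP[] := H1 (Ordinal lt_kn, j) => [|/eqP -> //]; rewrite ?eqxx // ltnNge lb.
Qed.

Definition hadd (s : nat) (h : {ffun 'I_s -> nat}) (e : {ffun 'I_s -> bool}) :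
  {ffun 'I_s -> nat} := [ffun j => (h j + e j)%N].

(** The columns in [e] receive an entry [k] in their first blank cell. *)
Definition add_entry (n s : nat) (k : 'I_n) (G : filling n s)
    (e : {ffun 'I_s -> bool}) : filling n s :=
  [ffun p : 'I_n * 'I_s =>
    if (p.1 == ht G p.2 :> nat) && e p.2 then widen_ord (leqnSn n) k else G p].

Definition del_entry (n s : nat) (k : 'I_n) (G : filling n s) : filling n s :=
  [ffun p => if G p == k :> nat then ord_max else G p].

Definition entry_cols (n s : nat) (k : 'I_n) (G : filling n s) :
  {ffun 'I_s -> bool} := [ffun j => [exists i, G (i, j) == k :> nat]].

Lemma ltn_addb (i h : nat) (b : bool) :
  (i < h + b)%N = (i < h)%N || ((i == h) && b).
Proof. by case: b; lia. Qed.

Lemma ht_add (n s : nat) (k : 'I_n) (G : filling n s) e :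
  tab k G -> ht (add_entry k G e) = hadd (ht G) e.
Proof.
move=> tG; apply/ffunP => j; rewrite [RHS]ffunE [LHS]ffunE.
have le_hn : (ht G j + e j <= n)%N.
  by have := ht_le j tG (ltnW (ltn_ord k)); case: (e j) (ltn_ord k); lia.
rewrite -[RHS](card_ord_lt le_hn); apply: eq_card => i; rewrite !inE ltn_addb ffunE /=.
case: ifP => [_|_]; first by rewrite orbT ord_neq_max; apply: (ltn_ord k).
by rewrite orbF (htE _ _ tG).
Qed.

Lemma haddE (s : nat) (h : {ffun 'I_s -> nat}) e j : hadd h e j = (h j + e j)%N.
Proof. exact: ffunE. Qed.

Lemma add_entryE (n s : nat) (k : 'I_n) (G : filling n s) e i j :
  add_entry k G e (i, j) =
  if (i == ht G j :> nat) && e j then widen_ord (leqnSn n) k else G (i, j).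
Proof. exact: ffunE. Qed.

(** As [k] exceeds all entries of [G], the columns of the extended filling
    always increase, and its rows do exactly when the new heights form a
    partition. *)
Lemma tab_add (n s : nat) (k : 'I_n) (G : filling n s) e :
  tab k G -> tab k.+1 (add_entry k G e) = nonincr (hadd (ht G) e).
Proof.
move=> tG; have [H1 H2 H3] := tabP _ _ tG.
(* Each cell is either in use, with an entry below k, or blank. *)
have cell_dich (i : 'I_n) (j : 'I_s) :
    (i < ht G j)%N && (G (i, j) < k)%N || (ht G j <= i)%N && (G (i, j) == n :> nat).
  have := H1 (i, j); have := htE i j tG; rewrite [(ht G j <= i)%N]leqNgt -val_eqE /= => <-.
  by case: eqP => //= _; rewrite !orbF.
apply/idP/idP => [/ht_nonincr|/nonincrP dh]; first by rewrite ht_add.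
apply/tabP; split.
- move=> p; rewrite ffunE; case: ifP => _; first by rewrite /= leqnn.
  by have := H1 p; rewrite -val_eqE /=; lia.
- move=> i j j' jj'; have := dh _ _ jj'; rewrite !haddE !add_entryE.
  have := cell_dich i j; have := cell_dich i j'.
  have := ltn_ord k; have := H2 i _ _ jj'.
  by case: (e j) (e j') => [] [] /=; rewrite ?andbT ?andbF; repeat case: ifP => /=; lia.
- move=> j i i' ii'; rewrite !add_entryE -!val_eqE /=.
  have := cell_dich i j; have := cell_dich i' j.
  have := ltn_ord k; have := H3 j _ _ ii'; rewrite -val_eqE /=.
  by case: (e j) => /=; rewrite ?andbT ?andbF; repeat case: ifP => /=; lia.
Qed.

Lemma tab_del (n s : nat) (k : 'I_n) (G : filling n s) :
  tab k.+1 G -> tab k (del_entry k G).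
Proof.
move=> /tabP [H1 H2 H3]; apply/tabP; split.
- move=> p; rewrite ffunE; case: (eqVneq (G p : nat) k) => [_|nG]; first by rewrite eqxx orbT.
  by case/orP: (H1 p) => [|->]; rewrite ?orbT // ltnS leq_eqVlt (negPf nG) /= => ->.
- move=> i j j' jj'; rewrite !ffunE; have := H2 i _ _ jj'.
  have := H1 (i, j); have := H1 (i, j'); rewrite -!val_eqE /=.
  have := ltn_ord k; have := ltn_ord (G (i, j)).
  by do 2 case: ifP => /=; lia.
- move=> j i i' ii'; rewrite !ffunE; have := H3 j _ _ ii'.
  have := H1 (i, j); have := H1 (i', j); rewrite -!val_eqE /=.
  have := ltn_ord k; have := ltn_ord (G (i, j)).
  by do 2 case: ifP => /=; lia.
Qed.

Lemma del_add (n s : nat) (k : 'I_n) (G : filling n s) e :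
  tab k G -> del_entry k (add_entry k G e) = G.
Proof.
move=> tG; apply/ffunP => -[i j]; rewrite ffunE add_entryE.
case: ((i == ht G j :> nat) && e j) / andP => [[/eqP ij _]|_] /=.
  by rewrite eqxx; apply/esym/eqP; rewrite -[_ == _]negbK (htE _ _ tG) -ij ltnn.
have [H1 _ _] := tabP _ _ tG; case: eqP => // eG.
by have := H1 (i, j); rewrite eG ltnn /= => /eqP.
Qed.

Lemma entry_cols_add (n s : nat) (k : 'I_n) (G : filling n s) e :
  tab k G -> entry_cols k (add_entry k G e) = e.
Proof.
move=> tG; apply/ffunP => j; rewrite ffunE; apply/existsP/idP => [[i]|ej].
  rewrite ffunE /=; case: ifP => [/andP[_ ->] //|_].
  have [H1 _ _] := tabP _ _ tG; have := H1 (i, j); rewrite -val_eqE /=.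
  by have := ltn_ord k; lia.
have lt_hn := leq_ltn_trans (ht_le j tG (ltnW (ltn_ord k))) (ltn_ord k).
by exists (Ordinal lt_hn); rewrite ffunE /= eqxx ej /=.
Qed.

(** A column of a tableau with entries at most [k] contains [k] at most once,
    at its foot; this is why the columns that contain [k] determine where it
    was. *)
Lemma add_del (n s : nat) (k : 'I_n) (G : filling n s) :
  tab k.+1 G -> add_entry k (del_entry k G) (entry_cols k G) = G.
Proof.
move=> tG; have [H1 _ H3] := tabP _ _ tG.
(* The rows above an entry k are those that remain in use when k is deleted. *)
have ht_k i j : G (i, j) = k :> nat -> ht (del_entry k G) j = i.
  move=> eG; rewrite ffunE -[RHS](card_ord_lt (ltnW (ltn_ord i))).
  apply: eq_card => i'; rewrite !inE ffunE; have := ltn_ord k.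
  have := H1 (i', j); rewrite -!val_eqE /=.
  case: (ltngtP i' i) => [lt|gt|/ord_inj ->]; last by rewrite eG eqxx /= eqxx.
    by have := H3 j _ _ lt; rewrite -val_eqE /= eG; case: ifP => /=; lia.
  by have := H3 j _ _ gt; rewrite -val_eqE /= eG; case: ifP => /=; lia.
apply/ffunP => -[i j]; rewrite add_entryE [entry_cols _ _ _]ffunE [del_entry _ _ _]ffunE.
case: andP => [[/eqP ij /existsP[i0 /eqP eG]]|nex].
  have <- : i0 = i by apply: ord_inj; rewrite ij (ht_k _ _ eG).
  by apply: ord_inj; rewrite eG.
case: eqP => // eG; case: nex; rewrite (ht_k _ _ eG) eqxx.
by split=> //; apply/existsP; exists i; apply/eqP.
Qed.

Definition weight (R : comPzRingType) (n s : nat) (wt : 'I_n.+1 -> R)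
    (G : filling n s) : R :=
  \prod_p wt (G p).

(** Giving weight 1 to blanks makes the weight a product over the whole rectangle. *)
Lemma weight_add (R : comPzRingType) (n s : nat) (wt : 'I_n.+1 -> R) (k : 'I_n)
    (G : filling n s) e : wt ord_max = 1 -> tab k G ->
  weight wt (add_entry k G e) =
  weight wt G * wt (widen_ord (leqnSn n) k) ^+ (\sum_j e j)%N.
Proof.
move=> wt1 tG; rewrite /weight expr_sum.
rewrite (eq_bigr (fun p => wt (add_entry k G e (p.1, p.2)))); last by case.
rewrite [X in X * _](eq_bigr (fun p => wt (G (p.1, p.2)))); last by case.
rewrite -(pair_bigA _ (fun i j => wt (add_entry k G e (i, j)))).
rewrite -(pair_bigA _ (fun i j => wt (G (i, j)))) /=.
rewrite [LHS]exchange_big [X in X * _]exchange_big /= -big_split /=.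
apply: eq_bigr => j _.
have lt_hn := leq_ltn_trans (ht_le j tG (ltnW (ltn_ord k))) (ltn_ord k).
pose i0 := Ordinal lt_hn.
rewrite (bigD1 i0) // [X in X * _](bigD1 i0) //= ffunE eqxx /=.
have -> : G (i0, j) = ord_max by apply/eqP; rewrite -[_ == _]negbK (htE _ _ tG) ltnn.
rewrite wt1 mul1r mulrC; congr (_ * _); last by case: (e j); rewrite ?expr1 ?expr0 ?wt1.
by apply: eq_bigr => i; rewrite -val_eqE ffunE /= => /negPf ->.
Qed.

(** Branching rule: [del_entry] and [entry_cols] invert [add_entry], so that a
    tableau with entries at most [k] is a tableau with entries below [k]
    together with an admissible set of columns. *)
Lemma sum_tabS (R : comPzRingType) (A : lmodType R) (n s : nat) (k : 'I_n)
    (F : filling n s -> A) :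
  \sum_(G | tab k.+1 G) F G =
  \sum_(G : filling n s | tab k G)
    \sum_(e | nonincr (hadd (ht G) e)) F (add_entry k G e).
Proof.
rewrite pair_big_dep.
rewrite (reindex_onto (fun p => add_entry k p.1 p.2)
           (fun G => (del_entry k G, entry_cols k G))) /=; last exact: add_del.
apply: eq_bigl => -[G e] /=; apply/andP/andP => -[].
  move=> tG /eqP [eG _]; have tG' : tab k G by rewrite -eG; apply: tab_del.
  by rewrite -(tab_add e tG').
by move=> tG dh; rewrite (tab_add e tG) del_add // entry_cols_add.
Qed.

Lemma tab0 (n s : nat) (G : filling n s) : tab 0 G = (G == [ffun=> ord_max]).
Proof.
apply/idP/eqP => [/tabP [H _ _]|->].
  by apply/ffunP => p; rewrite ffunE; exact/eqP/H.
by apply/tabP; split=> *; rewrite !ffunE ?eqxx ?orbT.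
Qed.

(** If the one-step extensions of every shape sum up to a factor [f k],
    independent of the shape, the generating function is a product.  By
    induction on the number of entries: [sum_tabS] peels off the largest one,
    and the hypothesis evaluates the inner sum. *)
Lemma sum_tab (K : comPzRingType) (R : comAlgType K) (n s : nat) (wt : 'I_n.+1 -> R)
    (C : {ffun 'I_s -> nat} -> K) (f : 'I_n -> R) :
  wt ord_max = 1 ->
  (forall h (k : 'I_n), nonincr h ->
     \sum_(e | nonincr (hadd h e))
        C (hadd h e) *: wt (widen_ord (leqnSn n) k) ^+ (\sum_j e j)%N = C h *: f k) ->
  \sum_(G : filling n s | tab n G) C (ht G) *: weight wt G =
  C [ffun=> 0%N] *: \prod_k f k.
Proof.
move=> wt1 pieri.
suff H k : (k <= n)%N -> \sum_(G : filling n s | tab k G) C (ht G) *: weight wt G =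
     C [ffun=> 0%N] *: \prod_(i < n | (i < k)%N) f i.
  by rewrite H //; congr (_ *: _); apply: eq_bigl => i; rewrite ltn_ord.
elim: k => [_|k IH lt_kn].
  rewrite (eq_bigl _ _ (@tab0 n s)) big_pred1_eq big_pred0 // /weight big1 ?scaler1.
    congr (C _ *: _); apply/ffunP => j; rewrite !ffunE eq_card0 // => i.
    by rewrite !inE ffunE eqxx.
  by move=> p _; rewrite ffunE.
pose k' := Ordinal lt_kn.
rewrite (sum_tabS k') (bigD1 k') //= mulrC scalerAl.
rewrite (eq_bigl (fun i : 'I_n => (i < k)%N)); last first.
  by move=> i; rewrite -val_eqE /= ltnS ltn_neqAle andbC.
rewrite -(IH (ltnW lt_kn)) big_distrl /=; apply: eq_bigr => G tG.
rewrite -scalerAl scalerAr -(pieri _ _ (ht_nonincr tG)) big_distrr /=.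
by apply: eq_bigr => e _; rewrite ht_add // weight_add // scalerAr.
Qed.

(** * Fillings and Schur polynomials *)

(** The transpose of [l], padded to [s] columns. *)
Definition cols (s : nat) (l : seq nat) : {ffun 'I_s -> nat} :=
  [ffun j : 'I_s => count (fun p => j < p)%N l].

(** Transposition: cell (i, j) is in the diagram by rows iff it is by columns. *)
Lemma nth_count (l : seq nat) (i j : nat) :
  is_part l -> (j < nth 0 l i)%N = (i < count (fun p => j < p)%N l)%N.
Proof.
rewrite /is_part; elim: l i => [|x l IH] i; first by rewrite nth_nil.
have geq_tr : transitive geq by move=> a b c /= ba ac; apply: leq_trans ac ba.
rewrite /= (path_sortedE geq_tr) => /andP [/allP x_ge sl].
case: (ltnP j x) => jx; first by case: i => [|i] /=; rewrite ?jx // add1n ltnS IH.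
have c0 : count (fun p => j < p)%N l = 0%N.
  by apply/eqP; rewrite -leqn0 leqNgt -has_count; apply/hasPn => y /x_ge yx;
     rewrite -leqNgt (leq_trans yx).
by rewrite add0n c0 ltn0; case: i => [|i] /=; rewrite ?IH // ?c0 // ltnNge jx.
Qed.

Definition varX (m : nat) (v : 'I_m.+1) : {mpoly rat[m]} :=
  if unlift ord_max v is Some i then 'X_i else 1.
Arguments varX : clear implicits.

Lemma varX_max (m : nat) : varX m ord_max = 1.
Proof. by rewrite /varX unlift_none. Qed.

Lemma varX_lift (m : nat) (i : 'I_m) : varX m (lift ord_max i) = 'X_i.
Proof. by rewrite /varX liftK. Qed.

Lemma widen_lift (m : nat) (i : 'I_m) : widen_ord (leqnSn m) i = lift ord_max i.
Proof. by apply: ord_inj; rewrite lift_max. Qed.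

Lemma cell_out (l : seq nat) (c : cell l) : (nth 0 l (cell_row c) <= cell_col c)%N = false.
Proof. by rewrite leqNgt; apply/negbF/(ltn_ord (tagged c)). Qed.

Section CellsAsPositions.
Variables (n s : nat) (l : seq nat).
Hypotheses (pl : is_part l) (szl : (size l <= n.+1)%N).
Hypothesis (rl : all (fun p => p <= s.+1)%N l).

Definition cell_pos (c : cell l) : 'I_n.+1 * 'I_s.+1 :=
  (inord (cell_row c), inord (cell_col c)).

Lemma cell_posE (c : cell l) :
  ((cell_pos c).1 = cell_row c :> nat) * ((cell_pos c).2 = cell_col c :> nat).
Proof.
split; rewrite inordK //; first exact: leq_trans (ltn_ord _) szl.
apply: leq_trans (ltn_ord (tagged c)) _.
by apply: (allP rl); apply: mem_nth.
Qed.

Lemma cell_pos_inj : injective cell_pos.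
Proof.
move=> c d /eqP; rewrite -pair_eqE /= => /andP [/eqP e1 /eqP e2].
have := cell_posE c; have := cell_posE d; rewrite /= e1 e2 => -[-> ->] [].
case: c {e1 e2} => i j; case: d => i' j'; rewrite /cell_row /cell_col /=.
by move=> /ord_inj ei; move: j; rewrite -ei => j /ord_inj ->.
Qed.

(** [cell_pos] identifies the cells of [l] with the positions of its diagram. *)
Lemma cell_posP (p : 'I_n.+1 * 'I_s.+1) :
  reflect (exists c, cell_pos c = p) (p.2 < nth 0 l p.1)%N.
Proof.
apply: (iffP idP) => [lt_p|[c <-]]; last first.
  by rewrite !cell_posE; apply: ltn_ord.
have lt_i : (p.1 < size l)%N.
  by rewrite ltnNge; apply/negP => le_i; rewrite nth_default in lt_p.
exists (Tagged (fun i : 'I_(size l) => 'I_(nth 0 l i))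
          (Ordinal lt_p : 'I_(nth 0 l (Ordinal lt_i)))).
case: p lt_p lt_i => i j lt_p lt_i.
by rewrite /cell_pos /cell_row /cell_col /= !inord_val.
Qed.

Definition tableau_of (G : filling n.+1 s.+1) : {ffun cell l -> 'I_n.+1} :=
  [ffun c => odflt ord0 (unlift ord_max (G (cell_pos c)))].

Definition filling_of (T : {ffun cell l -> 'I_n.+1}) : filling n.+1 s.+1 :=
  [ffun p => if [pick c | cell_pos c == p] is Some c then lift ord_max (T c) else ord_max].

Lemma filling_of_pos T c : filling_of T (cell_pos c) = lift ord_max (T c).
Proof.
by rewrite ffunE; case: pickP => [d /eqP /cell_pos_inj -> //|/(_ c)]; rewrite eqxx.
Qed.

Lemma filling_of_out T p : (filling_of T p == ord_max) = (nth 0 l p.1 <= p.2)%N.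
Proof.
rewrite ffunE leqNgt; case: pickP => [d /eqP <-|nc].
  rewrite -[RHS]/(~~ _); have -> : ((cell_pos d).2 < nth 0 l (cell_pos d).1)%N.
    by apply/cell_posP; exists d.
  by apply/negP => /eqP /esym /eqP; apply/negP; apply: neq_lift.
by rewrite eqxx; apply/esym/cell_posP => -[c ec]; have := nc c; rewrite ec eqxx.
Qed.

(** Comparisons between two cells of the diagram are the same on both sides;
    those that involve a blank hold since the diagram is closed to the left
    and upwards. *)
Lemma is_ssyt_filling T :
  is_ssyt T = tab n.+1 (filling_of T).
Proof.
have fT c : filling_of T (cell_pos c) = T c :> nat.
  by rewrite filling_of_pos lift_max.
have eta (c : cell l) : cell_pos c = ((cell_pos c).1, (cell_pos c).2) by [].
apply/idP/tabP => [/forallP sT|[_ H2 H3]]; last first.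
  apply/forallP => c; apply/forallP => d; apply/andP; split; apply/implyP => /andP [/eqP e lt].
    rewrite -!fT eta [cell_pos d]eta.
    have -> : (cell_pos c).1 = (cell_pos d).1 by apply: ord_inj; rewrite !cell_posE.
    by apply: H2; rewrite !cell_posE ltnW.
  rewrite -!fT eta [cell_pos d]eta.
  have -> : (cell_pos c).2 = (cell_pos d).2 by apply: ord_inj; rewrite !cell_posE.
  have := H3 (cell_pos d).2 (cell_pos c).1 (cell_pos d).1; rewrite !cell_posE => /(_ lt).
  by rewrite -eta filling_of_out !cell_posE cell_out orbF.
have leT c d : cell_row c = cell_row d -> (cell_col c < cell_col d)%N -> (T c <= T d)%N.
  by move=> e lt; have /forallP/(_ d)/andP[/implyP + _] := sT c; apply; rewrite e eqxx.
have ltT c d : cell_col c = cell_col d -> (cell_row c < cell_row d)%N -> (T c < T d)%N.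
  by move=> e lt; have /forallP/(_ d)/andP[_ /implyP] := sT c; apply; rewrite e eqxx.
split.
- by move=> p; rewrite -ord_neq_max orNb.
- move=> i j j'; rewrite leq_eqVlt => /predU1P [/ord_inj -> //|jj'].
  case: (leqP (nth 0 l i) j') => [|lt_j'].
    by rewrite -(filling_of_out T (i, j')) => /eqP ->; rewrite -ltnS ltn_ord.
  have [c ec] := cell_posP (i, j) (ltn_trans jj' lt_j').
  have [d ed] := cell_posP (i, j') lt_j'.
  rewrite -ec -ed !fT; apply: leT; rewrite -!cell_posE ?ec ?ed //.
- move=> j i i' ii'; case: (leqP (nth 0 l i') j) => [|lt_j].
    by rewrite -(filling_of_out T (i', j)) => ->; rewrite orbT.
  have lt_j' : (j < nth 0 l i)%N.
    by rewrite nth_count // (ltn_trans ii') // -nth_count.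
  have [c ec] := cell_posP (i, j) lt_j'.
  have [d ed] := cell_posP (i', j) lt_j.
  by rewrite -ec -ed !fT ltT // -!cell_posE ?ec ?ed.
Qed.

Lemma ht_eq_cols (G : filling n.+1 s.+1) : tab n.+1 G ->
  (ht G == cols s.+1 l) = [forall p, (G p == ord_max) == (nth 0 l p.1 <= p.2)%N].
Proof.
move=> tG; apply/eqP/forallP => [hG [i j]|HG].
  apply/eqP; rewrite -[LHS]negbK (htE _ _ tG) hG ffunE.
  by rewrite [RHS]leqNgt /= nth_count.
apply/ffunP => j; rewrite !ffunE.
rewrite -[RHS](@card_ord_lt n.+1); last by apply: leq_trans (count_size _ _) szl.
by apply: eq_card => i; rewrite !inE (eqP (HG (i, j))) /= -ltnNge nth_count.
Qed.

(** [filling_of] is a weight-preserving bijection from the tableaux of shape [l]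
    to the fillings with the column heights of [l]. *)
Lemma schur_filling :
  \sum_(G : filling n.+1 s.+1 | tab n.+1 G && (ht G == cols s.+1 l))
    weight (varX n.+1) G
  = schur n.+1 l.
Proof.
rewrite (reindex_onto filling_of tableau_of) /=; last first.
  move=> G /andP [tG]; rewrite ht_eq_cols // => /forallP HG; apply/ffunP => p.
  rewrite [LHS]ffunE; case: pickP => [c /eqP <-|nc].
    rewrite ffunE; case: unliftP => [v -> //|] /= /eqP.
    by rewrite (eqP (HG _)) !cell_posE cell_out.
  apply/esym/eqP; rewrite (eqP (HG p)) leqNgt; apply/cell_posP => -[c ec].
  by have := nc c; rewrite ec eqxx.
rewrite /schur; apply: eq_big => [T|T _].
  have -> : tableau_of (filling_of T) = T.
    by apply/ffunP => c; rewrite ffunE filling_of_pos liftK.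
  rewrite eqxx andbT is_ssyt_filling; case tT: (tab _ _) => //=.
  by rewrite ht_eq_cols //; apply/forallP => p; rewrite filling_of_out.
rewrite /weight (bigID (fun p => p \in [set cell_pos c | c in predT])) /=.
rewrite big_imset /=; last by move=> c d _ _; apply: cell_pos_inj.
rewrite [X in _ * X]big1 ?mulr1.
  by apply: eq_bigr => c _; rewrite filling_of_pos varX_lift.
move=> p /imsetP np; have /eqP -> : filling_of T p == ord_max.
  by rewrite filling_of_out leqNgt; apply/cell_posP => -[c ec]; case: np; exists c.
exact: varX_max.
Qed.
End CellsAsPositions.

(** Groups the tableaux by shape.  A family of partitions may be used to index
    the shapes as soon as it meets every shape with a nonzero coefficient
    exactly once. *)
Lemma sum_tab_schur (K : finType) (n s : nat) (C : {ffun 'I_s.+1 -> nat} -> rat)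
    (P : pred K) (l : K -> seq nat) :
  (forall i, P i -> [&& is_part (l i), (size (l i) <= n.+1)%N
                      & all (fun p => p <= s.+1)%N (l i)]) ->
  {in P &, injective (fun i => cols s.+1 (l i))} ->
  (forall h, nonincr h -> (forall j, h j <= n.+1)%N -> C h != 0 ->
     exists2 i, P i & cols s.+1 (l i) = h) ->
  \sum_(G : filling n.+1 s.+1 | tab n.+1 G) C (ht G) *: weight (varX n.+1) G =
  \sum_(i | P i) C (cols s.+1 (l i)) *: schur n.+1 (l i).
Proof.
move=> lP linj lsur.
transitivity (\sum_(i | P i)
    \sum_(G : filling n.+1 s.+1 | tab n.+1 G && (ht G == cols s.+1 (l i)))
      C (ht G) *: weight (varX n.+1) G); last first.
  apply: eq_bigr => i Pi; have /and3P [h1 h2 h3] := lP i Pi.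
  rewrite -(schur_filling h1 h2 h3) scaler_sumr.
  by apply: eq_bigr => G /andP [_ /eqP ->].
rewrite (exchange_big_dep (fun G => tab n.+1 G)) /=; last by move=> i G _ /andP[].
apply: eq_bigr => G tG; rewrite tG /=.
have [->|nC] := eqVneq (C (ht G)) 0.
  by rewrite big1 ?scale0r // => i _; rewrite scale0r.
have [i Pi ei] := lsur _ (ht_nonincr tG) (fun j => ht_le j tG (leqnn _)) nC.
rewrite (big_pred1 i) // => i'; apply/andP/eqP => [[Pi' /eqP e]|->]; last by rewrite ei eqxx.
by apply: linj => //; rewrite ei e.
Qed.

(** * The local rule for shapes with three columns *)

Definition ffun3 (T : Type) (x y z : T) : {ffun 'I_3 -> T} :=
  [ffun j : 'I_3 => nth x [:: x; y; z] j].

Definition col0 : 'I_3 := Ordinal (isT : 0 < 3)%N.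
Definition col1 : 'I_3 := Ordinal (isT : 1 < 3)%N.
Definition col2 : 'I_3 := Ordinal (isT : 2 < 3)%N.

Lemma ffun3E (T : Type) (x y z : T) :
  (ffun3 x y z col0 = x) * (ffun3 x y z col1 = y) * (ffun3 x y z col2 = z).
Proof. by rewrite !ffunE. Qed.

Lemma eq_ffun3 (T : Type) (f : {ffun 'I_3 -> T}) : f = ffun3 (f col0) (f col1) (f col2).
Proof.
by apply/ffunP => -[[|[|[|//]]] lt]; rewrite ffunE /=; congr (f _); apply: ord_inj.
Qed.

Lemma nonincr3 (h : {ffun 'I_3 -> nat}) :
  nonincr h = (h col2 <= h col1)%N && (h col1 <= h col0)%N.
Proof.
apply/nonincrP/andP => [H|[h12 h01] j j']; first by split; apply: H.
rewrite (eq_ffun3 h).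
by case: j j' => [[|[|[|//]]] ?] [[|[|[|//]]] ?] //= _; rewrite !ffunE //=; lia.
Qed.

Lemma sum_ffun3 (A : nmodType) (P : pred {ffun 'I_3 -> bool})
    (F : {ffun 'I_3 -> bool} -> A) :
  \sum_(e | P e) F e =
  \sum_x \sum_y \sum_z if P (ffun3 x y z) then F (ffun3 x y z) else 0.
Proof.
rewrite big_mkcond pair_bigA pair_bigA /=.
rewrite (reindex (fun p : bool * bool * bool => ffun3 p.1.1 p.1.2 p.2)) //=.
exists (fun f => (f col0, f col1, f col2)) => [[[x y] z] _|f _]; first by rewrite /= !ffun3E.
by rewrite -eq_ffun3.
Qed.

(** The columns of (3^k, 2^b, 1^z) have heights k + b + z, k + b and k;
    coefficients are given as functions of z, b and k. *)
Definition mcoef (c : nat -> nat -> nat -> rat) (h : {ffun 'I_3 -> nat}) : rat :=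
  c (h col0 - h col1)%N (h col1 - h col2)%N (h col2).

(** The identities between the coefficients of y, y^2 and y^3 in the condition
    of [sum_tab], for f = 1 + f1 y + f2 y^2 + f3 y^3.  A term that lengthens
    column j + 1 but not column j is absent when both have the same height,
    that is when [z] (for the first two columns) or [b] (for the last two) is
    0. *)
Definition pieri3 (c : nat -> nat -> nat -> rat) (f1 f2 f3 : rat) : Prop :=
  forall z b k,
  [/\ c z.+1 b k + (if z is z'.+1 then c z' b.+1 k else 0)
        + (if b is b'.+1 then c z b' k.+1 else 0) = f1 * c z b k,
      c z b.+1 k + (if b is b'.+1 then c z.+1 b' k.+1 else 0)
        + (if z is z'.+1 then c z' b k.+1 else 0) = f2 * c z b k
    & c z b k.+1 = f3 * c z b k].

Lemma sum_tab3 (R : comAlgType rat) (n : nat) (wt : 'I_n.+1 -> R) c f1 f2 f3 :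
  wt ord_max = 1 -> pieri3 c f1 f2 f3 ->
  \sum_(G : filling n 3 | tab n G) mcoef c (ht G) *: weight wt G =
  c 0%N 0%N 0%N *: \prod_k (1 + f1 *: wt (widen_ord (leqnSn n) k)
    + f2 *: wt (widen_ord (leqnSn n) k) ^+ 2 + f3 *: wt (widen_ord (leqnSn n) k) ^+ 3).
Proof.
move=> wt1 pc; rewrite (sum_tab (C := mcoef c)
  (f := fun k => 1 + f1 *: wt (widen_ord (leqnSn n) k)
    + f2 *: wt (widen_ord (leqnSn n) k) ^+ 2 + f3 *: wt (widen_ord (leqnSn n) k) ^+ 3)) //.
  by rewrite /mcoef !ffunE.
move=> h k; rewrite nonincr3 => /andP [h21 h10]; set y := wt _.
pose d := h col2; pose b := (h col1 - h col2)%N; pose z := (h col0 - h col1)%N.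
have e1 : h col1 = (d + b)%N by rewrite subnKC.
have e0 : h col0 = (d + b + z)%N by rewrite -e1 subnKC.
(* The coefficient contributed by lengthening column i iff xi holds. *)
pose t (x1 x2 x3 : bool) : rat := if (d + x3 <= d + b + x2 <= d + b + z + x1)%N
  then c (d + b + z + x1 - (d + b + x2))%N (d + b + x2 - (d + x3))%N (d + x3)%N else 0.
have tE z' b' d' (x1 x2 x3 : bool) : (d + x3 = d')%N -> (d + b + x2 = d' + b')%N ->
    (d + b + z + x1 = d' + b' + z')%N -> t x1 x2 x3 = c z' b' d'.
  move=> h3 h2 h1; rewrite /t h1 h2 h3 leq_addr leq_addr /=.
  by rewrite !addKn.
transitivity (\sum_x1 \sum_x2 \sum_x3 t x1 x2 x3 *: y ^+ (x1 + x2 + x3)).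
  rewrite sum_ffun3; do 3 (apply: eq_bigr => ? _).
  rewrite nonincr3 /mcoef !haddE !ffun3E /t e0 e1 -/d.
  case: ifP => _; last by rewrite scale0r.
  by rewrite !big_ord_recl big_ord0 addn0 addnA !ffunE.
have [p1 p2 p3] := pc z b d.
rewrite /mcoef -/z -/b -/d !big_bool /= !(addn0, addn1, add0n, addnn, expr0, expr1).
rewrite (tE z b d.+1 true true true) ?(tE z b.+1 d true true false);
  rewrite ?(tE z.+1 b d true false false) ?(tE z b d false false false); try lia.
have -> : t true false true = if b is b'.+1 then c z.+1 b' d.+1 else 0.
  by case eb: b => [|b']; [rewrite /t ifF //; lia | apply: tE; lia].
have -> : t false true true = if z is z'.+1 then c z' b d.+1 else 0.
  by case ez: z => [|z']; [rewrite /t ifF //; lia | apply: tE; lia].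
have -> : t false true false = if z is z'.+1 then c z' b.+1 d else 0.
  by case ez: z => [|z']; [rewrite /t ifF //; lia | apply: tE; lia].
have -> : t false false true = if b is b'.+1 then c z b' d.+1 else 0.
  by case eb: b => [|b']; [rewrite /t ifF //; lia | apply: tE; lia].
rewrite !scalerDr !scalerA ![c z b d * _]mulrC -p1 -p2 -p3 !scalerDl.
ring.
Qed.

(** Coefficients for f = 1 + y^2. *)
Definition coef2_plus (z b k : nat) : rat :=
  if (k == 0%N) && ~~ odd z then (-1) ^+ z./2 else 0.

(** Coefficients for f = 1 - y^2. *)
Definition coef2_minus (z b k : nat) : rat :=
  if (k == 0%N) && ~~ odd z then (-1) ^+ b else 0.

(** Coefficients for f = (1 + y)(1 + y^2). *)
Definition coef3_plus (z b k : nat) : rat := (tau z b)%:~R.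

(** Coefficients for f = (1 + y)(1 - y^2).  The coefficient -1 of y^3 in f
    forces a change of sign with each further part 3. *)
Definition coef3_minus (z b k : nat) : rat :=
  (-1) ^+ k * (2%:R * omega 0 z b - (tau z b)%:~R).

Lemma pieri_coef2_plus : pieri3 coef2_plus 0 1 0.
Proof.
move=> [|[|z]] [|b] [|k]; rewrite /coef2_plus /= ?negbK; split;
  try case: (odd z); rewrite /= ?exprS; ring.
Qed.

Lemma pieri_coef2_minus : pieri3 coef2_minus 0 (-1) 0.
Proof.
move=> [|[|z]] [|b] [|k]; rewrite /coef2_minus /= ?negbK; split;
  try case: (odd z); rewrite /= ?exprS; ring.
Qed.

Lemma tau_mod (q r q' r' : nat) : tau (q * 4 + r) (q' * 4 + r') = tau r r'.
Proof. by rewrite /tau /table !modnMDl. Qed.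

Lemma mod4_ind (P : nat -> Prop) :
  (forall q, P (q * 4 + 0)%N) -> (forall q, P (q * 4 + 1)%N) ->
  (forall q, P (q * 4 + 2)%N) -> (forall q, P (q * 4 + 3)%N) -> forall n, P n.
Proof.
move=> P0 P1 P2 P3 n; rewrite (divn_eq n 4).
by case: (n %% 4)%N (ltn_pmod n (isT : 0 < 4)%N) => [|[|[|[|]]]].
Qed.

Lemma tau0l (q r' : nat) : tau 0 (q * 4 + r') = tau 0 r'.
Proof. exact: (tau_mod 0 0). Qed.
Lemma tau0r (q r : nat) : tau (q * 4 + r) 0 = tau r 0.
Proof. exact: (tau_mod q r 0 0). Qed.
Lemma tau1l (q r' : nat) : tau 1 (q * 4 + r') = tau 1 r'.
Proof. exact: (tau_mod 0 1). Qed.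
Lemma tau1r (q r : nat) : tau (q * 4 + r) 1 = tau r 1.
Proof. exact: (tau_mod q r 0 1). Qed.

(** The two walls and the interior, for all residues of [z] and [b] modulo 4.
    The recurrences also involve predecessors, so [z] and [b] are first split
    into 0 and successors. *)
Lemma pieri_coef3_plus : pieri3 coef3_plus 1 1 1.
Proof.
move=> [|z] [|b] k; rewrite /coef3_plus; [|elim/mod4_ind: b => p|elim/mod4_ind: z => q|
  elim/mod4_ind: z => q; elim/mod4_ind: b => p];
  rewrite -?addnS ?(tau_mod, tau0l, tau0r, tau1l, tau1r); split; by [].
Qed.

(** [omega] is quasi-linear: affine in the quotients for fixed residues modulo 4. *)
Lemma omega_mod (e q r q' r' : nat) : omega e (q * 4 + r) (q' * 4 + r') =
  omega e r r' + ((alpha e r r').1%:~R * q'%:R + (alpha e r r').2%:~R * q%:R).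
Proof.
have am x y : alpha e (x * 4 + y) = alpha e y.
  by rewrite /alpha /table -(modn_dvdm (x * 4 + y) (isT : (2 %| 4)%N)) modnMDl modn_dvdm.
have am' z x y : alpha e z (x * 4 + y) = alpha e z y.
  by rewrite /alpha /table -(modn_dvdm (x * 4 + y) (isT : (2 %| 4)%N)) modnMDl modn_dvdm.
rewrite /omega am am'.
have -> : beta e (q * 4 + r) (q' * 4 + r') = beta e r r' by rewrite /beta /table !modnMDl.
by field.
Qed.

Lemma omega0l (e q r' : nat) :
  omega e 0 (q * 4 + r') = omega e 0 r' + (alpha e 0 r').1%:~R * q%:R.
Proof. by rewrite (omega_mod e 0 0) mulr0 addr0. Qed.
Lemma omega1l (e q r' : nat) :
  omega e 1 (q * 4 + r') = omega e 1 r' + (alpha e 1 r').1%:~R * q%:R.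
Proof. by rewrite (omega_mod e 0 1) mulr0 addr0. Qed.
Lemma omega0r (e q r : nat) :
  omega e (q * 4 + r) 0 = omega e r 0 + (alpha e r 0).2%:~R * q%:R.
Proof. by rewrite (omega_mod e q r 0 0) mulr0 add0r. Qed.
Lemma omega1r (e q r : nat) :
  omega e (q * 4 + r) 1 = omega e r 1 + (alpha e r 1).2%:~R * q%:R.
Proof. by rewrite (omega_mod e q r 0 1) mulr0 add0r. Qed.

(** By [omega_mod], for fixed residues both sides are affine functions of the
    quotients, and are compared formally. *)
Lemma pieri_coef3_minus : pieri3 coef3_minus 1 (-1) (-1).
Proof.
move=> [|z] [|b] k; rewrite /coef3_minus; [|elim/mod4_ind: b => p|elim/mod4_ind: z => q|
  elim/mod4_ind: z => q; elim/mod4_ind: b => p];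
  rewrite -?addnS ?(tau_mod, tau0l, tau0r, tau1l, tau1r);
  rewrite ?(omega_mod, omega0l, omega0r, omega1l, omega1r);
  rewrite /omega /tau /alpha /beta /table /= !exprS;
  split; by field.
Qed.

(** For [k] even this is the definition of [coef3_minus]; for [k] odd it is the
    identity between [omega 0], [omega 1] and [tau]. *)
Lemma omega_avg (z b k : nat) :
  2%:R^-1 * (coef3_plus z b k + coef3_minus z b k) = omega (odd k) z b.
Proof.
have -> : coef3_minus z b k = 2%:R * omega (odd k) z b - (tau z b)%:~R.
  rewrite /coef3_minus -signr_odd; case: (odd k); last by rewrite expr0 mul1r.
  have -> : omega 1 z b = (tau z b)%:~R - omega 0 z b; last by rewrite expr1 /=; ring.
  elim/mod4_ind: z => q; elim/mod4_ind: b => p; rewrite tau_mod !omega_mod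
    /omega /tau /alpha /beta /table /=; by field.
by rewrite /coef3_plus; field.
Qed.

(** * Reading the expansion as a sum over partitions *)

Lemma prod_sum_tab (m : nat) c f1 f2 f3 (F : 'I_m -> {mpoly rat[m]}) :
  pieri3 c f1 f2 f3 -> c 0%N 0%N 0%N = 1 ->
  (forall k, F k = 1 + f1 *: 'X_k + f2 *: 'X_k ^+ 2 + f3 *: 'X_k ^+ 3) ->
  \prod_k F k = \sum_(G : filling m 3 | tab m G) mcoef c (ht G) *: weight (varX m) G.
Proof.
move=> pc c1 EF; rewrite (sum_tab3 (varX_max m) pc) c1 scale1r.
by apply: eq_bigr => k _; rewrite EF widen_lift varX_lift.
Qed.

Lemma avg_sum_tab (m : nat) c d (P Q : {mpoly rat[m]}) :
  P = \sum_(G : filling m 3 | tab m G) mcoef c (ht G) *: weight (varX m) G ->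
  Q = \sum_(G : filling m 3 | tab m G) mcoef d (ht G) *: weight (varX m) G ->
  (2%:R^-1 : rat) *: (P + Q) = \sum_(G : filling m 3 | tab m G)
     mcoef (fun z b k => 2%:R^-1 * (c z b k + d z b k)) (ht G) *: weight (varX m) G.
Proof.
move=> -> ->; rewrite -big_split scaler_sumr; apply: eq_bigr => G _.
by rewrite /= -scalerDl scalerA.
Qed.

Definition part12 (b j : nat) : seq nat := nseq b 2%N ++ nseq j.*2 1%N.

Lemma cols_part12 b j : cols 3 (part12 b j) = ffun3 (b + j.*2)%N b 0%N.
Proof.
apply/ffunP => -[[|[|[|//]]] lt]; rewrite !ffunE /= count_cat !count_nseq /=; lia.
Qed.

Lemma is_part12 b j : is_part (part12 b j).
Proof.
have p1 x k : (0 < x)%N -> path geq x (nseq k 1%N) by elim: k x => //= k IH x ->; apply: IH.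
have p2 : path geq 2 (part12 b j) by elim: b => [|b IH]; [apply: p1 | exact: IH].
exact: path_sorted p2.
Qed.

(** If a coefficient is nonzero only for shapes with at most two columns, of
    heights that differ by an even number, these are the (2^b, 1^(2j)). *)
Lemma sum_part12 (n : nat) c (Q : nat -> nat -> bool) :
  (forall z b k, c z b k != 0 -> [&& k == 0%N, ~~ odd z & Q b z./2]) ->
  \sum_(G : filling n.+1 3 | tab n.+1 G) mcoef c (ht G) *: weight (varX n.+1) G =
  \sum_(b < n.+2) \sum_(j < n.+2 | (b + j.*2 <= n.+1)%N && Q b j)
    c j.*2 b 0%N *: schur n.+1 (part12 b j).
Proof.
move=> cQ; rewrite pair_big_dep /=.
rewrite (sum_tab_schur
  (P := fun p : 'I_n.+2 * 'I_n.+2 => (p.1 + p.2.*2 <= n.+1)%N && Q p.1 p.2)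
  (l := fun p => part12 p.1 p.2)).
- apply: eq_bigr => -[b j] _; congr (_ *: _).
  by rewrite cols_part12 /mcoef !ffun3E /= subn0 addKn.
- move=> [b j] /andP [le _] /=; rewrite is_part12 size_cat !size_nseq le.
  by rewrite all_cat !all_nseq !orbT.
- move=> [b j] [b' j'] _ _ /=; rewrite !cols_part12 => /ffunP E.
  have := E col0; have := E col1; rewrite !ffun3E => eb ej.
  by congr (_, _); apply: ord_inj => /=; lia.
- move=> h; rewrite nonincr3 /mcoef => /andP [h21 h10] hn /cQ /and3P [/eqP h2 ez Qh].
  have := hn col0; have := hn col1 => hn1 hn0.
  have ej : ((h col0 - h col1)./2.*2 = h col0 - h col1)%N by rewrite even_halfK.
  exists (inord (h col1), inord (h col0 - h col1)./2).
    rewrite /= !inordK ?ej; try lia.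
    by move: Qh; rewrite h2 subn0 => ->; lia.
  rewrite cols_part12 /= !inordK ?ej; try lia.
  by rewrite [RHS]eq_ffun3 h2; congr ffun3; lia.
Qed.

(** With parts bounded by [s] and a prescribed length, transposition loses nothing. *)
Lemma cols_inj (s : nat) (l l' : seq nat) :
  is_part l -> is_part l' -> size l = size l' ->
  all (fun p => p <= s)%N l -> all (fun p => p <= s)%N l' ->
  cols s l = cols s l' -> l = l'.
Proof.
move=> pl pl' sz ls ls' /ffunP E; apply: (@eq_from_nth _ 0%N) => // i lt_i.
have le1 : (nth 0 l i <= s)%N by apply: (allP ls); apply: mem_nth.
have le2 : (nth 0 l' i <= s)%N by apply: (allP ls'); apply: mem_nth; rewrite -sz.
have H j : (j < s)%N -> (j < nth 0 l i)%N = (j < nth 0 l' i)%N.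
  by move=> lt_j; rewrite !nth_count //; have := E (Ordinal lt_j); rewrite !ffunE /= => ->.
case: (ltngtP (nth 0 l i) (nth 0 l' i)) => // lt.
  by have := H _ (leq_trans lt le2); rewrite ltnn lt.
by have := H _ (leq_trans lt le1); rewrite ltnn lt.
Qed.

Lemma count_iota_lt (a m : nat) : (a <= m)%N -> count (fun i => i < a)%N (iota 0 m) = a.
Proof.
move=> am; rewrite -{1}(subnKC am) iotaD count_cat add0n.
rewrite (eq_in_count (a2 := predT)) ?count_predT ?size_iota; last first.
  by move=> i; rewrite mem_iota => /andP[_ ->].
rewrite [X in (_ + X)%N](eq_in_count (a2 := pred0)) ?count_pred0 ?addn0 // => i.
by rewrite mem_iota leqNgt => /andP [/negbTE ->].
Qed.

(** The transpose of [h]: its i-th part counts the columns that reach row i. *)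
Lemma part_of_cols (m : nat) (h : {ffun 'I_3 -> nat}) :
  nonincr h -> (forall j, h j <= m)%N ->
  exists2 t : m.-tuple 'I_4, is_part (tpart t) & cols 3 (tpart t) = h.
Proof.
rewrite nonincr3 => /andP [h21 h10] hm.
pose g i := ((i < h col0)%N + (i < h col1)%N + (i < h col2)%N)%N.
have g4 i : (g i < 4)%N 
  by rewrite /g; case: (i < h col0)%N (i < h col1)%N (i < h col2)%N => [] [] [].
pose t := [tuple (inord (g i) : 'I_4) | i < m].
have et : tpart t = [seq g i | i <- iota 0 m].
  rewrite /tpart /= -map_comp -val_enum_ord -map_comp.
  by apply: eq_map => i /=; rewrite inordK.
exists t; rewrite et.
  apply: (homo_sorted (e := leq)) (iota_sorted 0 m) => x y xy; rewrite /= /g; lia.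
apply/ffunP => j; rewrite ffunE count_map -[RHS](count_iota_lt (hm j)).
apply: eq_count => i /=; rewrite /g; move: j => [[|[|[|//]]] lt] /=.
- by rewrite (_ : Ordinal lt = col0); [lia | apply: ord_inj].
- by rewrite (_ : Ordinal lt = col1); [lia | apply: ord_inj].
- by rewrite (_ : Ordinal lt = col2); [lia | apply: ord_inj].
Qed.

Lemma count_mem_succ (l : seq nat) (k : nat) :
  count_mem k.+1 l = (count (fun p => k < p)%N l - count (fun p => k.+1 < p)%N l)%N.
Proof.
suff -> : count (fun p => k < p)%N l =
    (count_mem k.+1 l + count (fun p => k.+1 < p)%N l)%N by rewrite addnK.
by elim: l => //= x l ->; lia.
Qed.

Lemma nth_conj_part (l : seq nat) (j : nat) :
  is_part l -> nth 0%N (conj_part l) j = count (fun p => j < p)%N l.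
Proof.
move=> pl; rewrite /conj_part; case: (ltnP j (head 0%N l)) => [lt_j|le_j].
  by rewrite (nth_map 0%N) ?size_iota // nth_iota.
rewrite nth_default ?size_map ?size_iota //; apply/esym/eqP.
by rewrite -leqn0 leqNgt -nth_count // nth0 -leqNgt.
Qed.

Lemma tau_partE (l : seq nat) : tau_part l = mcoef coef3_plus (cols 3 l).
Proof. by rewrite /tau_part /mcoef /coef3_plus !count_mem_succ !ffunE. Qed.

(** Shortening all columns by the same even number changes neither the
    multiplicities of 1 and 2 nor the parity of the third column. *)
Lemma omega_partE (l : seq nat) : is_part l ->
  omega_part l =
  mcoef (fun z b k => 2%:R^-1 * (coef3_plus z b k + coef3_minus z b k)) (cols 3 l).
Proof.
move=> pl; rewrite /mcoef omega_avg /omega_part !nth_conj_part // !ffunE /=.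
have le21 : (count (fun p => 2 < p) l <= count (fun p => 1 < p) l)%N.
  by apply: sub_count => p /ltnW.
move: le21; set h2 := count _ l; set h1 := count _ l; set h0 := count _ l => le21.
by congr (omega _ _ _); have := odd_double_half h2; lia.
Qed.

Lemma sum_tpart (n : nat) c (coef : seq nat -> rat) :
  (forall l, is_part l -> coef l = mcoef c (cols 3 l)) ->
  \sum_(G : filling n.+1 3 | tab n.+1 G) mcoef c (ht G) *: weight (varX n.+1) G =
  \sum_(t : n.+1.-tuple 'I_4 | is_part (tpart t) && dgle (tpart t) (nseq n.+1 3%N))
    coef (tpart t) *: schur n.+1 (tpart t).
Proof.
move=> Ec.
have le3 (t : n.+1.-tuple 'I_4) : all (fun p => p <= 3)%N (tpart t).
  by apply/allP => p /mapP [i _ ->]; rewrite -ltnS.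
have sz (t : n.+1.-tuple 'I_4) : size (tpart t) = n.+1 by rewrite size_map size_tuple.
have dg (t : n.+1.-tuple 'I_4) : dgle (tpart t) (nseq n.+1 3%N).
  apply/allP => i; rewrite mem_iota sz add0n => /andP[_ lt_i].
  by rewrite nth_nseq lt_i; apply: (allP (le3 t)); apply: mem_nth; rewrite sz.
rewrite (sum_tab_schur (P := fun t : n.+1.-tuple 'I_4 => is_part (tpart t))
  (l := fun t => tpart t)).
- by apply: eq_big => [t|t pt]; [rewrite dg andbT | rewrite Ec].
- by move=> t -> /=; rewrite sz leqnn le3.
- move=> t t' pt pt' e; apply: val_inj; apply: (inj_map (@ord_inj 4)).
  by apply: (cols_inj (s := 3)) e => //; rewrite !sz.
- by move=> h dh hn _; apply: part_of_cols.
Qed.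

Theorem mainTheorem2 (m : nat) (hm : (0 < m)%N) :
  (\prod_(i < m) (1 + 'X_i ^+ 2) =
     \sum_(b < m.+1) \sum_(j < (m - b)./2.+1)
       (-1) ^+ j *: schur m (nseq b 2%N ++ nseq j.*2 1%N)
     :> {mpoly rat[m]})
  /\
  ((2%:R^-1 : rat) *: (\prod_(i < m) (1 + 'X_i ^+ 2) +
                         \prod_(i < m) (1 - 'X_i ^+ 2) : {mpoly rat[m]}) =
     (* (b + 2j, b) contained in (m^2) forces b, j <= m, so the sum ranges over all b, j >= 0 *)
     \sum_(b < m.+1) \sum_(j < m.+1 |
         dgle [:: b + j.*2; nat_of_ord b]%N (nseq 2 m) && ~~ odd (b + j))
       (-1) ^+ j *: schur m (nseq b 2%N ++ nseq j.*2 1%N)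
     :> {mpoly rat[m]})
  /\
  (\prod_(i < m) ((1 + 'X_i) * (1 + 'X_i ^+ 2)) =
     \sum_(t : m.-tuple 'I_4 | is_part (tpart t) && dgle (tpart t) (nseq m 3%N))
       tau_part (tpart t) *: schur m (tpart t)
     :> {mpoly rat[m]})
  /\
  ((2%:R^-1 : rat) *: (\prod_(i < m) ((1 + 'X_i) * (1 + 'X_i ^+ 2))
                         + \prod_(i < m) ((1 + 'X_i) * (1 - 'X_i ^+ 2))
                         : {mpoly rat[m]}) =
     \sum_(t : m.-tuple 'I_4 | is_part (tpart t) && dgle (tpart t) (nseq m 3%N))
       omega_part (tpart t) *: schur m (tpart t)
     :> {mpoly rat[m]}).
Proof.
case: m hm => [//|n] _.
pose Z c : {mpoly rat[n.+1]} :=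
  \sum_(G : filling n.+1 3 | tab n.+1 G) mcoef c (ht G) *: weight (varX n.+1) G.
have EA : \prod_(i < n.+1) (1 + 'X_i ^+ 2) = Z coef2_plus.
  apply: (prod_sum_tab pieri_coef2_plus) => [//|k]; rewrite scale1r !scale0r; ring.
have EB : \prod_(i < n.+1) (1 - 'X_i ^+ 2) = Z coef2_minus.
  apply: (prod_sum_tab pieri_coef2_minus) => [//|k]; rewrite scaleN1r !scale0r; ring.
have EC : \prod_(i < n.+1) ((1 + 'X_i) * (1 + 'X_i ^+ 2)) = Z coef3_plus.
  apply: (prod_sum_tab pieri_coef3_plus) => [//|k]; rewrite !scale1r; ring.
have ED : \prod_(i < n.+1) ((1 + 'X_i) * (1 - 'X_i ^+ 2)) = Z coef3_minus.
  apply: (prod_sum_tab pieri_coef3_minus) => [//|k]; rewrite scale1r !scaleN1r; ring.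
split; [|split; [|split]].
- rewrite EA /Z (@sum_part12 n _ (fun _ _ => true)) => [|z b k]; last first.
    by rewrite /coef2_plus andbT; case: (_ && _); rewrite ?eqxx.
  apply: eq_bigr => b _.
  have le_b : ((n.+1 - b)./2.+1 <= n.+2)%N by lia.
  rewrite (big_ord_widen _ (fun j => (-1) ^+ j *: schur n.+1 (part12 b j)) le_b).
  apply: eq_big => [j|j _]; first by have := ltn_ord b; rewrite andbT; lia.
  by rewrite /coef2_plus odd_double doubleK.
- rewrite (avg_sum_tab EA EB) (@sum_part12 n _ (fun b j => ~~ odd (b + j))) => [|z b k].
    apply: eq_bigr => b _; apply: eq_big => [j|j /andP [_ ev]].
      by rewrite /dgle /=; have := ltn_ord b; lia.
    congr (_ *: _); rewrite /coef2_plus /coef2_minus odd_double doubleK /=.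
    rewrite -(signr_odd _ b) -(signr_odd _ j); move: ev; rewrite oddD.
    by case: (odd b) (odd j) => [] [].
  rewrite /coef2_plus /coef2_minus; case: (k == 0%N); case: (odd z);
    rewrite /= ?addr0 ?mulr0 ?eqxx //.
  rewrite -(signr_odd _ b) -(signr_odd _ z./2) oddD.
  by case: (odd b) (odd z./2) => [] [].
- by rewrite EC; apply: sum_tpart => l _; apply: tau_partE.
- by rewrite (avg_sum_tab EC ED); apply: sum_tpart; apply: omega_partE.
Qed.
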